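(* Let $m\in\{1,2,\dots\}$ and let $p\in\left(0,\frac34\right)$. Then the positive equilibrium $\bar y=\frac{1+\sqrt{1+4p}}{2}$ of the difference equation $$y_{n+1}=1+p\,\frac{y_{n-m}}{y_n^{2}},\qquad n=0,1,2,\dots,$$ is locally asymptotically stable.
   Context: Solutions are sequences $\{y_n\}_{n=-m}^{\infty}$ of positive real numbers with positive initial values $y_{-m},\dots,y_0$. The equilibrium $\bar y$ is locally stable if for every $\varepsilon>0$ there is $\delta>0$ such that every solution with $\sum_{i=0}^{m}|y_{-i}-\bar y|<\delta$ satisfies $|y_n-\bar y|<\varepsilon$ for all $n\ge -m$; it is locally asymptotically stable if it is locally stable and there is $\gamma>0$ such that every solution with $\sum_{i=0}^{m}|y_{-i}-\bar y|<\gamma$ satisfies $\lim_{n\to\infty}y_n=\bar y$. *)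

(* Defs.v *)
From HB Require Import structures.
From mathcomp Require Import all_boot all_order all_algebra.
From mathcomp Require Import all_classical all_reals all_analysis.

Set Implicit Arguments.
Unset Strict Implicit.
Unset Printing Implicit Defensive.

Import Order.TTheory GRing.Theory Num.Theory.
Import numFieldNormedType.Exports.

Local Open Scope classical_set_scope.
Local Open Scope ring_scope.

(* A sequence (y_n)_{n >= -m} is encoded by a function on all of [int]; its
   values at indices below -m are unconstrained and never used. *)
Definition solution (R : realType) (m : nat) (p : R) (y : int -> R) : Prop :=
  (forall n : int, - m%:Z <= n -> 0 < y n) /\
  (forall n : nat, y (n%:Z + 1) = 1 + p * (y (n%:Z - m%:Z) / y n%:Z ^+ 2)).

(* Independent of m, since y_n and y_{n-m} agree along a constant solution. *)
Definition positive_equilibrium (R : realType) (p ybar : R) : Prop :=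
  0 < ybar /\ ybar = 1 + p * (ybar / ybar ^+ 2).

Definition locally_stable (R : realType) (m : nat) (p ybar : R) : Prop :=
  forall eps : R, 0 < eps -> exists2 delta : R, 0 < delta &
    forall y : int -> R, solution m p y ->
      \sum_(i < m.+1) `|y (- i%:Z) - ybar| < delta ->
      forall n : int, - m%:Z <= n -> `|y n - ybar| < eps.

Definition locally_asymptotically_stable
    (R : realType) (m : nat) (p ybar : R) : Prop :=
  locally_stable m p ybar /\
  exists2 gamma : R, 0 < gamma &
    forall y : int -> R, solution m p y ->
      \sum_(i < m.+1) `|y (- i%:Z) - ybar| < gamma ->
      y n%:Z @[n --> \oo] --> ybar.

(* Main.v *)
Require Import Defs.
From HB Require Import structures.
From mathcomp Require Import all_boot all_order all_algebra.
From mathcomp Require Import all_classical all_reals all_analysis.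
From mathcomp Require Import zify ring lra.

(** Write [f u v = 1 + p * (v / u ^+ 2)] for the right-hand side of the
    recurrence and [c] for the equilibrium, so that [p = c * (c - 1)].  The
    partial derivatives of [f] at [(c, c)] are [- 2 * p / c ^+ 2] and
    [p / c ^+ 2], whose absolute values sum to [3 * p / c ^+ 2]; this is less
    than [1] exactly when [c < 3 / 2], that is, when [p < 3 / 4].  No analysis of
    the characteristic polynomial is then needed, because [f] is a contraction
    for the sup norm near [(c, c)] ([equilibrium_contraction]): if [u] and [v]
    are within [M] of [c], with [M] small enough, then [f u v] is within
    [lam * M] of [c] for a fixed [lam < 1].

    A bound [M] on the initial deviations is therefore a bound on all of them,
    and it improves by a factor [lam] each time the index grows by [m.+1], the
    length of the window on which the recurrence depends
    ([delayed_contraction_decay]).  The first fact gives stability and the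
    second one convergence. *)

Import Order.TTheory GRing.Theory Num.Theory.
Import numFieldNormedType.Exports.

Local Open Scope classical_set_scope.
Local Open Scope ring_scope.

(** The equilibrium equation is [y ^+ 2 - y - p = 0]; its two roots sum to [1],
    so a root larger than [1] is the only positive one. *)
Lemma positive_equilibriumP (R : realType) (p c y : R) :
  1 < c -> p = c * (c - 1) -> positive_equilibrium p y <-> y = c.
Proof.
move=> c1 ->.
have c_neq0 : c != 0 by rewrite gt_eqF //; lra.
split=> [[y0 yE]|->]; last by split; [lra | field].
have y_neq0 : y != 0 by rewrite gt_eqF.
have y2 : y * y = y + c * (c - 1) by rewrite [LHS](congr1 ( *%R y) yE); field.
have : (y - c) * (y + c - 1) = 0 by nra.
by move/eqP; rewrite mulf_eq0 => /orP[]/eqP; lra.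
Qed.

(** The deviation splits into the errors in [v] and in [u]:
    [v / u ^+ 2 - c / c ^+ 2
      = (c * (v - c) - (u + c) * (u - c)) / (u ^+ 2 * c)].
    With [u] between [c - r] and [c + r] this yields the Lipschitz constant
    [(c - 1) * (3 * c + r) / (c - r) ^+ 2], which is [3 * (c - 1) / c < 1] at
    [r = 0] and hence stays below [1] for small [r]. *)
Lemma equilibrium_contraction (R : realType) (c : R) : 1 < c -> c < 3 / 2 ->
  exists r lam : R, [/\ 0 < r, 0 <= lam, lam < 1 &
    forall M u v : R, M <= r -> `|u - c| <= M -> `|v - c| <= M ->
      `|1 + c * (c - 1) * (v / u ^+ 2) - c| <= lam * M].
Proof.
move=> c1 c32.
(* The margin (c - r)^2 - (c - 1)(3c + r) is at least c(3 - 2c) - r(3c - 1),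
   so any r up to (3 - 2c) / 3 would do. *)
pose r := (3 - 2 * c) / 4.
have r0 : 0 < r by rewrite /r; lra.
have r4 : r < 1 / 4 by rewrite /r; lra.
have cr2 : 0 < (c - r) ^+ 2 by rewrite exprn_gt0 //; lra.
have num_ge0 : 0 <= (c - 1) * (3 * c + r) by apply: mulr_ge0; lra.
exists r, ((c - 1) * (3 * c + r) / (c - r) ^+ 2); split => //.
- by rewrite divr_ge0 // ltW.
- rewrite ltr_pdivrMr // mul1r.
  have : 0 < r * (c + 1 + r) by apply: mulr_gt0; lra.
  have : c * (3 - 2 * c) = 4 * r * c by rewrite /r; field.
  nra.
move=> M u v Mr uM vM.
have M0 : 0 <= M by apply: le_trans uM.
have /andP[ulo uhi] : c - r <= u <= c + r.
  by rewrite -ler_distl (le_trans uM).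
have u0 : 0 < u by lra.
have -> : 1 + c * (c - 1) * (v / u ^+ 2) - c =
          (c - 1) * (c * (v - c) - (u + c) * (u - c)) / u ^+ 2.
  by field; rewrite gt_eqF.
rewrite normrM normfV normrM (gtr0_norm (x := c - 1)) ?subr_gt0 //.
rewrite (gtr0_norm (x := u ^+ 2)) ?exprn_gt0 //.
have dev : `|c * (v - c) - (u + c) * (u - c)| <= (3 * c + r) * M.
  apply: le_trans (ler_normB _ _) _; rewrite !normrM.
  rewrite (gtr0_norm (x := c)) ?(gtr0_norm (x := u + c)); [|lra..].
  have : c * `|v - c| <= c * M by apply: ler_wpM2l => //; lra.
  have : (u + c) * `|u - c| <= (2 * c + r) * M by apply: ler_pM => //; lra.
  lra.
rewrite [leRHS]mulrAC -(mulrA _ _ M); apply: ler_pM.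
- by rewrite mulr_ge0 //; lra.
- by rewrite invr_ge0 exprn_ge0 // ltW.
- by apply: ler_wpM2l => //; lra.
- by rewrite lef_pV2 ?posrE ?cr2 ?exprn_gt0 //; nra.
Qed.

(** Each term from index [k.+1 * m.+1] on is computed from two terms of index at
    least [k * m.+1], so a contraction step is gained per block of length
    [m.+1]. *)
Lemma delayed_contraction_decay (R : realType) (m : nat) (lam M : R)
    (a : nat -> R) :
  0 <= lam -> lam < 1 -> 0 <= M -> (forall j, (j <= m)%N -> a j <= M) ->
  (forall n B, B <= M -> a (n + m)%N <= B -> a n <= B ->
     a (n + m).+1 <= lam * B) ->
  forall k j, (k * m.+1 <= j)%N -> a j <= lam ^+ k * M.
Proof.
move=> lam0 lam1 M0 init step; elim=> [|k IHk] j kj.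
  rewrite expr0 mul1r {kj}; elim/ltn_ind: j => j IHj.
  have [/init //|mj] := leqP j m.
  have -> : j = ((j - m.+1) + m).+1 by lia.
  apply: le_trans (_ : lam * M <= M); first by apply: step => //; apply: IHj; lia.
  by rewrite ler_piMl // ltW.
have -> : j = ((j - m.+1) + m).+1 by lia.
rewrite exprS -mulrA; apply: step; last 2 first.
- by apply: IHk; lia.
- by apply: IHk; lia.
- by rewrite ler_piMl // exprn_ile1 // ltW.
Qed.

(** Local contraction makes the total initial deviation [S] a bound that decays
    geometrically along the solution; indices are shifted by [m] so that the
    history [y (- m), ..., y 0] occupies the positions [0, ..., m]. *)
Lemma solution_decay (R : realType) (m : nat) (p c r lam : R) (y : int -> R) :
  let S := \sum_(i < m.+1) `|y (- i%:Z) - c| in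
  0 <= lam -> lam < 1 ->
  (forall M u v : R, M <= r -> `|u - c| <= M -> `|v - c| <= M ->
     `|1 + p * (v / u ^+ 2) - c| <= lam * M) ->
  solution m p y -> S <= r ->
  forall k j, (k * m.+1 <= j)%N -> `|y (j%:Z - m%:Z) - c| <= lam ^+ k * S.
Proof.
move=> S lam0 lam1 contr [_ yS] Sr.
apply: (delayed_contraction_decay _ _ _ _
          (fun j => `|y (j%:Z - m%:Z) - c|)) => //.
- by apply: sumr_ge0.
- move=> j jm; have im : (m - j < m.+1)%N by lia.
  rewrite /S (bigD1 (Ordinal im)) //=.
  have -> : j%:Z - m%:Z = - (m - j)%N%:Z by lia.
  by rewrite lerDl sumr_ge0.
- move=> n B BS.
  have -> : (n + m)%N%:Z - m%:Z = n%:Z by lia.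
  have -> : (n + m).+1%:Z - m%:Z = n%:Z + 1 by lia.
  by rewrite yS; apply: contr; apply: le_trans Sr.
Qed.

Lemma contraction_locally_asymptotically_stable (R : realType) (m : nat)
    (p c r lam : R) :
  0 < r -> 0 <= lam -> lam < 1 ->
  (forall M u v : R, M <= r -> `|u - c| <= M -> `|v - c| <= M ->
     `|1 + p * (v / u ^+ 2) - c| <= lam * M) ->
  locally_asymptotically_stable m p c.
Proof.
move=> r0 lam0 lam1 contr; split.
- move=> eps eps0; exists (Num.min eps r); first by rewrite lt_min eps0.
  move=> y ysol; rewrite lt_min => /andP[Seps /ltW Sr] n mn.
  apply: le_lt_trans Seps.
  have [j ->] : exists j : nat, n = j%:Z - m%:Z.
    by exists (absz (n + m%:Z)); lia.
  have := solution_decay _ _ _ _ _ _ _ lam0 lam1 contr ysol Sr 0 j (leq0n j).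
  by rewrite expr0 mul1r.
- exists r => // y ysol /ltW Sr.
  have decay := solution_decay _ _ _ _ _ _ _ lam0 lam1 contr ysol Sr.
  set S := \sum_(i < m.+1) _ in decay.
  have geo : lam ^+ k * S @[k --> \oo] --> (0 : R).
    rewrite -(mul0r S); apply: cvgM; last exact: cvg_cst.
    by apply: cvg_expr; rewrite ger0_norm.
  apply/cvgrPdist_lt => eps eps0.
  have /cvgrPdist_lt /(_ _ eps0) [k _ /(_ k (leqnn k))] := geo.
  rewrite /= sub0r normrN => /(le_lt_trans (ler_norm _)) keps.
  exists (k * m.+1)%N => // n /= kn.
  rewrite distrC; apply: le_lt_trans keps.
  have -> : n%:Z = (n + m)%N%:Z - m%:Z by lia.
  by apply: decay; lia.
Qed.

Theorem theorem10 (R : realType) (m : nat) (p : R)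
    (hm : (1 <= m)%N) (hp0 : 0 < p) (hp1 : p < 3 / 4) :
  let ybar := (1 + Num.sqrt (1 + 4 * p)) / 2 in
  (forall y : R, positive_equilibrium p y <-> y = ybar) /\
  locally_asymptotically_stable m p ybar.
Proof.
move=> ybar.
have sq : Num.sqrt (1 + 4 * p) ^+ 2 = 1 + 4 * p by rewrite sqr_sqrtr //; lra.
have sq0 := sqrtr_ge0 (1 + 4 * p).
have c1 : 1 < ybar by rewrite /ybar; nra.
have c32 : ybar < 3 / 2 by rewrite /ybar; nra.
have pE : p = ybar * (ybar - 1) by rewrite /ybar; nra.
split; first by move=> y; exact: positive_equilibriumP.
have [r [lam [r0 lam0 lam1 contr]]] := equilibrium_contraction _ _ c1 c32.
by rewrite pE in contr *; apply: contraction_locally_asymptotically_stable contr.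
Qed.
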